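(* Let $n\ge 3$. The subgroup $E\wr E\wr A_n$ is the monolith in $S_n\wr S_n\wr S_n$.
   Context: $S_n\wr S_n\wr S_n$ is the iterated permutational wreath product (with natural actions), the leftmost factor being the top group; it is the automorphism group of the finite $n$-regular rooted tree with three levels below the root, an element being given by one permutation of $S_n$ at the root (level 0), $n$ permutations at the vertices of level 1, and $n^2$ permutations at the vertices of level 2. $E$ is the trivial group, and $E\wr E\wr A_n$ is the subgroup of elements with trivial permutations on levels 0 and 1 and permutations from the alternating group $A_n$ at all $n^2$ vertices of level 2. The monolith of a group is its unique minimal nontrivial normal subgroup (the intersection of all nontrivial normal subgroups, when this is nontrivial).
   Formalization: The case n = 4 is excluded: there the claim is false, because the Klein four-group V is normal in S_4, so E wr E wr V is a nontrivial normal subgroup properly contained in E wr E wr A_4. *)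

(* Defs.v *)
From HB Require Import structures.
From mathcomp Require Import all_boot all_fingroup all_solvable.

Set Implicit Arguments.
Unset Strict Implicit.
Unset Printing Implicit Defensive.

Local Open Scope group_scope.

Section Wreath.

Variables X Y : finType.
Implicit Types (g : {perm X}) (h : {ffun X -> {perm Y}}).

Definition wr_fun g h (p : X * Y) : X * Y := (g p.1, h p.1 p.2).

Lemma wr_fun_inj g h : injective (wr_fun g h).
Proof. by move=> [x y] [x' y'] [/perm_inj <- /perm_inj <-]. Qed.

Definition wr_perm g h : {perm X * Y} := perm (@wr_fun_inj g h).

Lemma wr_permE g h x y : wr_perm g h (x, y) = (g x, h x y).
Proof. by rewrite permE. Qed.

(* MathComp permutations act on the right: s * t applies s first. *)
Lemma wr_permM g h g' h' :
  wr_perm g h * wr_perm g' h'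
    = wr_perm (g * g') [ffun x => h x * h' (g x)].
Proof.
by apply/permP=> -[x y]; rewrite permM !wr_permE ffunE !permM.
Qed.

Lemma wr_perm1 : wr_perm 1 [ffun=> 1] = 1.
Proof. by apply/permP=> -[x y]; rewrite wr_permE ffunE !perm1. Qed.

(* The permutational wreath product with top group G, in its natural
   (imprimitive) action on X * Y, where X * Y is seen as the union of the blocks
   {x} * Y permuted by G.  This action is faithful as soon as Y is nonempty. *)
Definition wreath_set (G : {set {perm X}}) (H : {set {perm Y}}) :
    {set {perm X * Y}} :=
  [set wr_perm g h | g in G, h in ffun_on (mem H)].

Lemma wreath_group_set (G : {group {perm X}}) (H : {group {perm Y}}) :
  group_set (wreath_set G H).
Proof.
apply/group_setP; split.
  apply/imset2P; exists 1 [ffun=> 1]; rewrite ?wr_perm1 ?group1 //.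
  by apply/ffun_onP=> x; rewrite ffunE group1.
move=> _ _ /imset2P[g h Gg /ffun_onP Hh ->] /imset2P[g' h' Gg' /ffun_onP Hh' ->].
rewrite wr_permM; apply: imset2_f; first by rewrite groupM.
by apply/ffun_onP=> x; rewrite ffunE groupM ?Hh ?Hh'.
Qed.

Definition wreath (G : {group {perm X}}) (H : {group {perm Y}}) :
  {group {perm X * Y}} := Group (wreath_group_set G H).

End Wreath.

Notation "G \wr H" := (wreath G H) (at level 40, left associativity) : Group_scope.

Section Monolith.

Variable gT : finGroupType.
Implicit Types G M N : {group gT}.

(* Unlike MathComp's minnormal, this requires M to be a subgroup of G. *)
Definition minimal_normal G M : bool :=
  [min M | (M <| G) && (M :!=: 1)].

Definition is_monolith G M : Prop :=
  minimal_normal G M /\ forall N, minimal_normal G N -> N :=: M.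

End Monolith.

(* Main.v *)
Require Import Defs.
From mathcomp Require Import all_boot all_fingroup all_solvable.

(** The subgroup (1 \wr 1) \wr 'Alt is, since 1 \wr 1 is trivial, the part with
    entries in 'Alt of the base group of the wreath product with top group
    G = 'Sym \wr 'Sym, which is transitive on the vertices of level 2, and
    bottom group H = 'Sym.  So the statement is an instance of
    [wreath_monolith]: for a transitive G and a centerless H with monolith A,
    the monolith of G \wr H is the base subgroup of all maps to A.

    The proof of [wreath_monolith] shows that a nontrivial normal subgroup N
    contains every element supported on one vertex with entry in A.  If a
    nontrivial s in N is not in the base group, then its commutator with a well
    chosen one-vertex element is, and is a nontrivial element of N
    ([normal_wreath_meets_base]).  A commutator of a base element with an element
    supported at x is again supported at x, and as H is centerless it can be
    made nontrivial ([normal_wreath_meets_factor]).  So the entries k for which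
    N contains the element k at x form a nontrivial normal subgroup of H, which
    contains A.  Transitivity of G moves this from x to all the other vertices,
    and one-vertex elements generate the base group.

    That 'Alt is the monolith of 'Sym in degree n >= 3, n <> 4 comes from the
    simplicity of 'Alt and from the fact that 'Sym is centerless with all its
    commutators in 'Alt ([Sym_monolith]). *)

Set Implicit Arguments.
Unset Strict Implicit.
Unset Printing Implicit Defensive.

Local Open Scope group_scope.

(** * Monoliths *)

(** In a finite group every nontrivial normal subgroup contains a minimal one,
    so a unique minimal normal subgroup lies below all of them. *)
Lemma is_monolithP (gT : finGroupType) (G M : {group gT}) :
  is_monolith G M <->
  [/\ M <| G, M :!=: 1 &
      forall N : {group gT}, N <| G -> N :!=: 1 -> M \subset N].
Proof.
split=> [[minM uniqM] | [nMG ntM leM]].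
  case/mingroupP: (minM) => /andP[nMG ntM] _; split=> // N nNG ntN.
  have [|K minK sKN] := @mingroup_exists _ (fun K => (K <| G) && (K :!=: 1)) N.
    by rewrite nNG.
  by rewrite -(uniqM K minK).
split=> [|N /mingroupP[/andP[nNG ntN] minN]].
  apply/mingroupP; split=> [|N /andP[nNG ntN] sNM]; first by rewrite nMG.
  by apply/eqP; rewrite eqEsubset sNM leM.
by rewrite -(minN M) ?leM // nMG.
Qed.

(** * Base group elements of a wreath product *)

Section WreathElements.

Variables X Y : finType.
Implicit Types (x z : X) (g : {perm X}) (k : {perm Y}).
Implicit Types (h : {ffun X -> {perm Y}}).

Lemma mem_wr_perm (G : {group {perm X}}) (H : {group {perm Y}}) g h :
  g \in G -> (forall x, h x \in H) -> wr_perm g h \in wreath G H.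
Proof. by move=> Gg Hh; apply: imset2_f => //; apply/ffun_onP. Qed.

Lemma wreathP (G : {group {perm X}}) (H : {group {perm Y}}) s :
  reflect (exists g h, [/\ g \in G, forall x, h x \in H & s = wr_perm g h])
          (s \in wreath G H).
Proof.
apply: (iffP idP) => [/imset2P[g h Gg /ffun_onP Hh ->] | [g [h [Gg Hh ->]]]].
  by exists g, h.
exact: mem_wr_perm.
Qed.

Lemma wr_perm_base_eq1 h : (wr_perm 1 h == 1) = [forall x, h x == 1].
Proof.
apply/eqP/forallP => [h1 x | h1].
  apply/eqP/permP=> y.
  by have := congr1 (fun s : {perm X * Y} => (s (x, y)).2) h1; rewrite wr_permE !perm1.
have ->: h = [ffun=> 1] by apply/ffunP=> x; rewrite ffunE (eqP (h1 x)).
exact: wr_perm1.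
Qed.

Lemma wr_perm_baseJ h g h' :
  wr_perm 1 h ^ wr_perm g h' =
    wr_perm 1 [ffun x => h (g^-1 x) ^ h' (g^-1 x)].
Proof.
apply: (mulgI (wr_perm g h')); rewrite -conjgC !wr_permM mul1g mulg1.
by congr wr_perm; apply/ffunP=> x; rewrite !ffunE perm1 permK -conjgC.
Qed.

Definition wr_at x k : {perm X * Y} :=
  wr_perm 1 [ffun z => if z == x then k else 1].

Lemma wr_atM x : {in setT &, {morph wr_at x : k k' / k * k'}}.
Proof.
move=> k k' _ _; rewrite wr_permM mulg1; congr wr_perm.
by apply/ffunP=> z; rewrite !ffunE perm1; case: ifP; rewrite ?mulg1.
Qed.

Canonical wr_at_morphism x := Morphism (@wr_atM x).

Lemma wr_atV x k : (wr_at x k)^-1 = wr_at x k^-1.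
Proof. by apply/esym/(morphV (wr_at_morphism x)); rewrite inE. Qed.

Lemma wr_atJ x k g h : wr_at x k ^ wr_perm g h = wr_at (g x) (k ^ h x).
Proof.
rewrite wr_perm_baseJ; congr wr_perm; apply/ffunP=> z; rewrite !ffunE.
by rewrite -(inj_eq (@perm_inj _ g)) permKV; case: eqP => [->|_];
  rewrite ?permK ?conj1g.
Qed.

(** The commutator is supported at x because the two elements commute at all
    other vertices. *)
Lemma wr_atR x k h : [~ wr_at x k, wr_perm 1 h] = wr_at x [~ k, h x].
Proof. by rewrite commgEl wr_atJ perm1 wr_atV -wr_atM ?inE // commgEl. Qed.

Lemma mem_wr_at (G : {group {perm X}}) (H : {group {perm Y}}) x k :
  k \in H -> wr_at x k \in wreath G H.
Proof. by move=> Hk; apply: mem_wr_perm => // z; rewrite ffunE; case: ifP. Qed.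

(** One-vertex elements generate the base group, by removing the support of h
    one vertex at a time. *)
Lemma wr_perm_base_mem (N : {group {perm X * Y}}) h :
  (forall x, wr_at x (h x) \in N) -> wr_perm 1 h \in N.
Proof.
move=> Nh.
pose h_ (r : seq X) := [ffun z => if z \in r then h z else 1].
have ->: h = h_ (enum X) by apply/ffunP=> z; rewrite ffunE mem_enum.
elim: (enum X) => [|x r IHr].
  have ->: h_ [::] = [ffun=> 1] by apply/ffunP=> z; rewrite !ffunE.
  by rewrite wr_perm1.
have [xr | /negbTE xr] := boolP (x \in r).
  have -> //: h_ (x :: r) = h_ r.
  by apply/ffunP=> z; rewrite !ffunE inE; case: eqP => // ->; rewrite xr.
have -> : wr_perm 1 (h_ (x :: r)) = wr_at x (h x) * wr_perm 1 (h_ r).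
  rewrite wr_permM mulg1; congr wr_perm; apply/ffunP=> z.
  rewrite !ffunE perm1 inE.
  by case: eqP => [->|_]; rewrite ?xr ?mulg1 ?mul1g.
exact: groupM.
Qed.

End WreathElements.

Lemma wreath11 (X Y : finType) : (wreath 1 1 = 1 :> {group {perm X * Y}})%G.
Proof.
apply/group_inj/trivgP/subsetP=> _ /wreathP[g [h [g1 h1 ->]]].
rewrite inE (set1gP g1) wr_perm_base_eq1.
by apply/forallP=> x; rewrite (set1gP (h1 x)).
Qed.

Lemma wreath_trans (X Y : finType) (G : {group {perm X}}) (H : {group {perm Y}}) :
    [transitive G, on setT | 'P] -> [transitive H, on setT | 'P] ->
  [transitive wreath G H, on setT | 'P].
Proof.
move=> trG trH; have [x0 _ _] := imsetP trG; have [y0 _ _] := imsetP trH.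
apply/imsetP; exists (x0, y0) => //; apply/esym/setP=> -[x y]; rewrite inE.
have [g Gg /= gx] := atransP2 trG (in_setT x0) (in_setT x).
have [k Hk /= ky] := atransP2 trH (in_setT y0) (in_setT y).
apply/orbitP; exists (wr_perm g [ffun=> k]).
  by apply: mem_wr_perm => // z; rewrite ffunE.
by rewrite /= apermE wr_permE ffunE gx ky.
Qed.

Lemma wreath1_normal (X Y : finType) (G : {group {perm X}})
    (A H : {group {perm Y}}) :
  A <| H -> wreath 1 A <| wreath G H.
Proof.
case/andP=> sAH nAH; apply/andP; split.
  apply/subsetP=> _ /wreathP[g [h [/set1gP-> Ah ->]]].
  by apply: mem_wr_perm => // x; apply: subsetP (Ah x).
apply/subsetP=> _ /wreathP[g [k [Gg Hk ->]]]; rewrite inE.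
apply/subsetP=> _ /imsetP[_ /wreathP[_ [h [/set1gP-> Ah ->]]] ->].
rewrite wr_perm_baseJ; apply: mem_wr_perm => // x.
by rewrite ffunE memJ_norm ?(subsetP nAH).
Qed.

(** * Normal subgroups of a wreath product *)

Section NormalSubgroups.

Variables (X Y : finType) (G : {group {perm X}}) (H : {group {perm Y}}).
Variable N : {group {perm X * Y}}.
Hypotheses (nNW : N <| wreath G H) (ntN : N :!=: 1).

Lemma normal_commg_mem s t : s \in N -> t \in wreath G H -> [~ t, s] \in N.
Proof.
move=> Ns Wt; rewrite commgEr groupM // memJ_norm ?groupV //.
by apply: subsetP Wt; case/andP: nNW.
Qed.

(** If the top part g of an element of N moves x, then its commutator with an
    element supported at x with entry k lies in the base group and has entry
    k^-1 at x, the other nontrivial entry being at g x. *)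
Lemma normal_wreath_meets_base :
  H :!=: 1 -> exists (h : {ffun X -> {perm Y}}) x,
    [/\ forall z, h z \in H, h x != 1 & wr_perm 1 h \in N].
Proof.
case/trivgPn=> k Hk ntk; have /trivgPn[s Ns nts] := ntN.
have /wreathP[g [h [Gg Hh def_s]]] := subsetP (normal_sub nNW) s Ns.
have [g1 | ntg] := eqVneq g 1.
  move: nts Ns; rewrite def_s g1 wr_perm_base_eq1 => /forallPn[x hx] Nh.
  by exists h, x.
have [x gx]: exists x, g x != x.
  apply/existsP; apply: contraNT ntg => /existsPn fix_g.
  by apply/eqP/permP=> x; rewrite perm1; apply/eqP/negbNE/fix_g.
have := normal_commg_mem Ns (mem_wr_at G x Hk).
rewrite commgEl def_s wr_atJ wr_atV wr_permM mulg1.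
set f := finfun _ => Nf; exists f, x; split=> // [z|].
  by rewrite !ffunE; apply: groupM; case: ifP; rewrite ?groupJ ?groupV.
by rewrite !ffunE eqxx perm1 [x == _]eq_sym (negbTE gx) mulg1 eq_invg1.
Qed.

(** The entry h x of a base element of N, if nontrivial, is not central in H, so
    taking the commutator with an element supported at x gives a nontrivial element of N
    supported at x. *)
Lemma normal_wreath_meets_factor :
  H :!=: 1 -> 'Z(H) = 1 -> exists x k, [/\ k \in H, k != 1 & wr_at x k \in N].
Proof.
move=> ntH ZH; have [h [x [Hh hx Nh]]] := normal_wreath_meets_base ntH.
have: h x \notin 'Z(H) by rewrite ZH inE.
rewrite inE Hh => /centP ncHh.
have [k Hk ntR]: exists2 k, k \in H & [~ k, h x] != 1.
  apply/exists_inP; apply: contraT => /exists_inPn cHh; case: ncHh => k Hk.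
  by apply/commute_sym/commgP/negbNE/cHh.
exists x, [~ k, h x]; split=> //; first exact: groupR.
by rewrite -wr_atR normal_commg_mem // mem_wr_at.
Qed.

(** The entries k of the elements of N supported at x form a normal subgroup of
    H, since the elements of the wreath product supported at x induce all of H
    on them. *)
Lemma normal_wreath_monolith (A : {group {perm Y}}) :
    [transitive G, on setT | 'P] -> 'Z(H) = 1 -> is_monolith H A ->
  wreath 1 A \subset N.
Proof.
move=> trG ZH /is_monolithP[nAH ntA leA].
have ntH: H :!=: 1 by apply: contra_neq ntA => H1; apply/trivgP; rewrite -H1 normal_sub.
have nN s t : s \in N -> t \in wreath G H -> s ^ t \in N.
  by move=> Ns Wt; rewrite memJ_norm //; apply: subsetP Wt; case/andP: nNW.
have [x0 [k0 [Hk0 ntk0 Nk0]]] := normal_wreath_meets_factor ntH ZH.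
pose K := (H :&: wr_at_morphism Y x0 @*^-1 N)%G.
have memK k : (k \in K) = (k \in H) && (wr_at x0 k \in N) by rewrite !inE.
have sAK: A \subset K.
  apply: leA; last by apply/trivgPn; exists k0; rewrite // memK Hk0.
  apply/andP; split; first exact: subsetIl.
  apply/subsetP=> t Ht; rewrite inE; apply/subsetP=> _ /imsetP[k Kk ->].
  move: Kk; rewrite !memK => /andP[Hk Nk]; rewrite groupJ //=.
  have := nN _ _ Nk (mem_wr_at G x0 Ht).
  by rewrite wr_atJ perm1 ffunE eqxx.
have NA x k : k \in A -> wr_at x k \in N.
  move=> Ak; have [g Gg /= ->] := atransP2 trG (in_setT x0) (in_setT x).
  have /(subsetP sAK) := Ak; rewrite memK => /andP[_ Nk].
  have Wg: wr_perm g [ffun=> 1] \in wreath G H.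
    by apply: mem_wr_perm => // z; rewrite ffunE.
  by have := nN _ _ Nk Wg; rewrite wr_atJ ffunE conjg1.
apply/subsetP=> _ /wreathP[_ [h [/set1gP-> Ah ->]]].
by apply: wr_perm_base_mem => x; apply: NA.
Qed.

End NormalSubgroups.

Theorem wreath_monolith (X Y : finType) (G : {group {perm X}})
    (A H : {group {perm Y}}) :
    [transitive G, on setT | 'P] -> 'Z(H) = 1 -> is_monolith H A ->
  is_monolith (wreath G H) (wreath 1 A).
Proof.
move=> trG ZH monA; have /is_monolithP[nAH ntA _] := monA.
apply/is_monolithP; split=> [||N nNW ntN]; first exact: wreath1_normal.
  have [x _ _] := imsetP trG; have /trivgPn[k Ak ntk] := ntA.
  apply/trivgPn; exists (wr_at x k); first exact: mem_wr_at.
  rewrite wr_perm_base_eq1; apply/forallPn; exists x.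
  by rewrite ffunE eqxx.
exact: normal_wreath_monolith nNW ntN _ trG ZH monA.
Qed.

(** * Symmetric and alternating groups *)

(** If s moves x to s x, and z is a third point, then s does not commute with
    the transposition of s x and z, which fixes x but moves s x. *)
Lemma center_Sym (T : finType) : 2 < #|T| -> 'Z('Sym_T) = 1.
Proof.
move=> T3; apply/trivgP/subsetP=> s /centerP[_ cs]; rewrite inE.
apply/eqP/permP=> x; rewrite perm1; apply/eqP; apply: contraLR T3 => sx.
rewrite -leqNgt -cardsT; apply: contraNT sx; rewrite -ltnNge => T3.
have [z]: exists z, z \notin [set x; s x].
  apply/existsP; apply: contraTT T3 => /existsPn sub2; rewrite -leqNgt.
  apply: leq_trans (_ : #|[set x; s x]| <= 2); last by rewrite cards2; case: eqP.
  by apply/subset_leq_card/subsetP=> z _; apply/negbNE/sub2.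
rewrite !inE negb_or => /andP[zx zsx].
have := congr1 (fun t : {perm T} => t x) (cs (tperm (s x) z) (in_setT _)).
rewrite !permM tpermL; case: (tpermP _ _ x) => // [<- // | xz | _ _ szx].
  by rewrite xz eqxx in zx.
by rewrite szx eqxx in zsx.
Qed.

(** A nontrivial normal subgroup contains a nontrivial commutator, which is an
    even permutation, so it meets the simple group 'Alt_T nontrivially. *)
Lemma Sym_monolith (T : finType) :
  2 < #|T| -> #|T| <> 4 -> is_monolith 'Sym_T%G 'Alt_T%G.
Proof.
move=> T3 T4.
have /simpleP[ntA simpA] : simple 'Alt_T.
  move: T3; rewrite leq_eqVlt => /orP[/eqP/esym/simple_Alt_3 // | ].
  by rewrite leq_eqVlt => /orP[/eqP/esym/T4 | /simple_Alt5].
apply/is_monolithP; split=> // [|N nNS ntN]; first exact: Alt_normal.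
have /trivgPn[s Ns nts] := ntN.
have: s \notin 'Z('Sym_T) by rewrite center_Sym ?inE.
rewrite inE in_setT => /centP ncs.
have [t ntR]: exists t, [~ s, t] != 1.
  apply/existsP; apply: contraT => /existsPn cs; case: ncs => t _.
  exact/commgP/negbNE/cs.
have NR: [~ s, t] \in N.
  have nNt: t \in 'N(N) by apply: subsetP (normal_norm nNS) _ (in_setT t).
  by rewrite commgEl groupM ?groupV ?memJ_norm.
have AR: [~ s, t] \in 'Alt_T.
  by rewrite Alt_even commgEl odd_permM odd_permV odd_permJ addbb.
case: (simpA ('Alt_T :&: N)%G) => [|NA1|/setIidPl //].
  by rewrite (normalGI (Alt_subset T)).
by case/negP: ntR; rewrite -in_set1 -[[set 1]]NA1 inE AR NR.
Qed.

(* The value n = 4 is excluded: the normal Klein four-group V of 'S_4 makes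
   1 \wr 1 \wr V a nontrivial normal subgroup properly contained in
   1 \wr 1 \wr 'Alt_('I_4). *)
Theorem proposition9 (n : nat) (hn : 3 <= n) (hn4 : n <> 4) :
  is_monolith ('Sym_('I_n) \wr 'Sym_('I_n) \wr 'Sym_('I_n))%G
              (1 \wr 1 \wr 'Alt_('I_n))%G.
Proof.
have trS: [transitive 'Sym_('I_n), on setT | 'P].
  have n_gt0: 0 < n by apply: ltn_trans hn.
  by apply: ntransitive1 n_gt0 _; have := Sym_trans 'I_n; rewrite card_ord.
rewrite wreath11; apply: wreath_monolith; first exact: wreath_trans.
  by apply: center_Sym; rewrite card_ord.
by apply: Sym_monolith; rewrite card_ord.
Qed.
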